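(* For all positive integers $n$ and all (Littlewood--Richardson) $n$-hives $H$ we have $(\sigma^{(n)})^2H=H$.
   Context: Partitions. A partition has weakly decreasing nonnegative integer parts; $\ell(\lambda)$ is the number of positive parts, $|\lambda|$ the sum of the parts. Partitions of length $\le n$ are padded with zeros to $n$ parts. Hives. An integer $n$-hive is a family of integers $a_{ij}$ ($0\le i\le j\le n$), $a_{00}=0$ (vertex labels of a triangular array of side $n$), with edge labels $\alpha_{ij}=a_{ij}-a_{i,j-1}$ ($0\le i<j\le n$), $\beta_{ij}=a_{ij}-a_{i-1,j}$, $\gamma_{ij}=a_{ij}-a_{i-1,j-1}$ ($1\le i\le j\le n$), such that for all $1\le i<j\le n$ the gradients $R_{ij}=\alpha_{i-1,j-1}-\alpha_{ij}$, $U_{ij}=\alpha_{ij}-\alpha_{i-1,j}=\beta_{ij}-\beta_{i,j-1}$, $L_{ij}=\beta_{i,j-1}-\beta_{i+1,j}$ are $\ge0$. Edge labels satisfy the triangle conditions $\gamma_{ij}=\alpha_{i-1,j}+\beta_{ij}$ and $\gamma_{ij}=\beta_{i,j-1}+\alpha_{ij}$ ($i<j$) and determine the hive. $U_{ij}$ is the $(i,j)$ upright rhombus gradient; the $j$-th diagonal comprises the upright rhombi $(i,j)$, $i=1,\dots,j-1$, and the triangle with bottom edge $\gamma_{jj}$. An LR hive is an integer hive with all edge labels $\ge0$. $\mathcal{H}^{(n)}(\lambda,\mu,\nu)$ is the set of LR $n$-hives with lower boundary $\gamma_{kk}=\lambda_k$, left boundary $\alpha_{0k}=\mu_k$, right boundary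 $\beta_{kn}=\nu_k$ ($1\le k\le n$), for partitions $\lambda,\mu,\nu$ of length $\le n$. Level $k$ of the left boundary is the edge $\alpha_{0k}$. Path removals on $H\in\mathcal{H}^{(r)}(\lambda,\mu,\nu)$ (changing edge labels): (i) $\chi_r$ (if $\nu_r>0$): decrease $\gamma_{rr}$ and $\beta_{rr}$ by 1. (ii) $\phi_r$ (if $U_{ir}>0$ for some $i<r$, equivalently $\lambda_r-\mu_r-\nu_r>0$): put $i_{r+1}=r$ and for $d=r,r-1,\dots$ let $i_d=\max\{i<i_{d+1}:U_{id}>0\}$ as long as this set is nonempty; let $k$ be the first $d$ for which it is empty, and put $i_k=0$ (so $1\le k<r$). Decrease by 1 the labels $\gamma_{rr}$, $\alpha_{id}$ for $i_d\le i<i_{d+1}$, and $\gamma_{id}$ for $i_d<i<i_{d+1}$ ($k\le d\le r$), and increase by 1 the labels $\beta_{i_d,d-1}$ ($k<d\le r$). The path is said to terminate at level $k$. (iii) $\omega_r$ (if $\mu_r>0$): decrease by 1 all $\alpha_{ir}$ ($0\le i<r$) and $\gamma_{ir}$ ($1\le i\le r$). Full $r$-hive path removal: $\theta_r=\omega_r^{\mu_r}\phi_r^{\lambda_r-\mu_r-\nu_r}\chi_r^{\nu_r}$ (rightmost acts first) if $\ell(\lambda)=r$, and the identity if $\ell(\lambda)<r$. It makes the $r$-th diagonal empty (boundary labels $\gamma_{rr},\alpha_{0r},\beta_{rr}$ and gradients $U_{ir}$ all zero). $\kappa_r$ deletes an empty $r$-th diagonal, turning the $r$-hive into an $(r-1)$-hive.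 The map $\sigma^{(n)}$. For $H\in\mathcal{H}^{(n)}(\lambda,\mu,\nu)$ set $H^{(n)}=H$ and $H^{(r-1)}=\kappa_r\theta_rH^{(r)}$ for $r=n,\dots,1$. For $1\le k<r\le n$ let $V_{kr}$ be the number of the $\phi_r$-paths removed in applying $\theta_r$ to $H^{(r)}$ that terminate at level $k$. Then $\sigma^{(n)}H=K\in\mathcal{H}^{(n)}(\lambda,\nu,\mu)$ is the hive with left boundary $\nu$, right boundary $\mu$ and upright rhombus gradients $V_{kr}$; that is, $\alpha_{ij}=\nu_j+\sum_{k\le i}V_{kj}$, $\beta_{ij}=\mu_i-\sum_{m>j}V_{im}$, $\gamma_{ij}=\alpha_{i-1,j}+\beta_{ij}$. *)

(* Defs.v *)
From mathcomp Require Import all_boot all_order all_algebra.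

Set Implicit Arguments.
Unset Strict Implicit.
Unset Printing Implicit Defensive.

Import Order.TTheory GRing.Theory Num.Theory.
Local Open Scope ring_scope.

(* Vertex labels a i j and edge labels are families indexed by all of nat * nat;
   for a hive of side n only the following entries are meaningful:
     a i j     for 0 <= i <= j <= n,
     alpha i j for 0 <= i < j <= n,
     beta i j, gamma i j for 1 <= i <= j <= n. *)
Definition vertices := nat -> nat -> int.

Record labels := Labels {
  alpha : nat -> nat -> int;
  beta  : nat -> nat -> int;
  gamma : nat -> nat -> int }.

Definition edges (a : vertices) : labels :=
  Labels (fun i j => a i j - a i j.-1)
         (fun i j => a i j - a i.-1 j)
         (fun i j => a i j - a i.-1 j.-1).

(* The vertex labels with a 0 0 = 0 are recovered from the edge labels by
   summing along the left boundary from (0,0) to (0,j), and then along the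
   beta-edges from (0,j) to (i,j). *)
Definition vertices_of (h : labels) : vertices :=
  fun i j => \sum_(1 <= l < j.+1) alpha h 0 l + \sum_(1 <= k < i.+1) beta h k j.

Definition Rgrad (h : labels) (i j : nat) : int :=
  alpha h i.-1 j.-1 - alpha h i j.
Definition Ugrad (h : labels) (i j : nat) : int :=
  alpha h i j - alpha h i.-1 j.
Definition Lgrad (h : labels) (i j : nat) : int :=
  beta h i j.-1 - beta h i.+1 j.

Definition is_hive (n : nat) (a : vertices) : Prop :=
  a 0 0 = 0 /\
  forall i j : nat, (1 <= i)%N -> (i < j)%N -> (j <= n)%N ->
    [/\ 0 <= Rgrad (edges a) i j, 0 <= Ugrad (edges a) i j
      & 0 <= Lgrad (edges a) i j].

Definition is_LR_hive (n : nat) (a : vertices) : Prop :=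
  [/\ is_hive n a,
      forall i j : nat, (i < j)%N -> (j <= n)%N -> 0 <= alpha (edges a) i j
    & forall i j : nat, (1 <= i)%N -> (i <= j)%N -> (j <= n)%N ->
        0 <= beta (edges a) i j /\ 0 <= gamma (edges a) i j].

Definition chi (r : nat) (h : labels) : labels :=
  Labels (alpha h)
         (fun i j => beta h i j - ((i == r) && (j == r))%:R)
         (fun i j => gamma h i j - ((i == r) && (j == r))%:R).

Definition omega (r : nat) (h : labels) : labels :=
  Labels (fun i j => alpha h i j - ((i < r)%N && (j == r))%:R)
         (beta h)
         (fun i j => gamma h i j - ((1 <= i <= r)%N && (j == r))%:R).

(* max {i | 1 <= i < m, U_{id} > 0}, or 0 if this set is empty. *)
Definition next_row (h : labels) (d m : nat) : nat :=
  \max_(1 <= i < m | 0 < Ugrad h i d) i.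

(* [path_from h r s] is i_{r+1-s}: it starts at i_{r+1} = r. As [next_row] is 0
   on an empty set, this gives i_k = 0 at the level k of termination (and
   i_d = 0 for d < k, which is never used). *)
Fixpoint path_from (h : labels) (r s : nat) : nat :=
  if s is t.+1 then next_row h (r - t)%N (path_from h r t) else r.

Definition path_row (h : labels) (r d : nat) : nat := path_from h r (r.+1 - d)%N.

(* d decreases from r, so the first d with no upright rhombus available is the
   largest one. *)
Definition level (h : labels) (r : nat) : nat :=
  \max_(1 <= d < r.+1 | path_row h r d == 0%N) d.

Definition phi (r : nat) (h : labels) : labels :=
  let k := level h r in
  let p := path_row h r in
  Labels
    (fun i d => alpha h i d - ((k <= d <= r) && (p d <= i < p d.+1))%N%:R)
    (fun i j => beta h i j + ((k < j.+1 <= r) && (i == p j.+1))%N%:R)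
    (fun i d => gamma h i d - ((k <= d <= r) && (p d < i < p d.+1))%N%:R
                            - ((i == r) && (d == r))%:R).

(* The length of the partition lambda = (gamma_11, ..., gamma_rr). *)
Definition ell (h : labels) (r : nat) : nat :=
  count (fun k => 0 < gamma h k k) (iota 1 r).

(* For an LR hive of side r the three exponents are nonnegative, and `|_| only
   casts them to nat. *)
Definition num_chi (h : labels) (r : nat) : nat := `|beta h r r|%N.
Definition num_phi (h : labels) (r : nat) : nat :=
  `|(gamma h r r - alpha h 0 r - beta h r r : int)|%N.
Definition num_omega (h : labels) (r : nat) : nat := `|alpha h 0 r|%N.

Definition theta (r : nat) (h : labels) : labels :=
  if ell h r == r then
    iter (num_omega h r) (omega r)
      (iter (num_phi h r) (phi r) (iter (num_chi h r) (chi r) h))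
  else h.

Definition kappa (r : nat) (h : labels) : labels :=
  let cut (f : nat -> nat -> int) := fun i j => if (j < r)%N then f i j else 0 in
  Labels (cut (alpha h)) (cut (beta h)) (cut (gamma h)).

(* [stage h n s] is H^(n-s). *)
Fixpoint stage (h : labels) (n s : nat) : labels :=
  if s is t.+1 then kappa (n - t) (theta (n - t) (stage h n t)) else h.

Definition hive_at (h : labels) (n r : nat) : labels := stage h n (n - r).

(* The number of phi_r-paths terminating at level k that are removed when
   theta_r is applied to h. *)
Definition num_level (h : labels) (k r : nat) : nat :=
  if ell h r == r then
    (\sum_(0 <= t < num_phi h r)
       (level (iter t (phi r) (iter (num_chi h r) (chi r) h)) r == k))%N
  else 0%N.

Definition Vgrad (h : labels) (n k r : nat) : nat := num_level (hive_at h n r) k r.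

Definition sigma_labels (n : nat) (h : labels) : labels :=
  let al := fun i j : nat =>
    beta h j n + \sum_(1 <= k < i.+1) (Vgrad h n k j)%:Z in
  let be := fun i j : nat =>
    alpha h 0 i - \sum_(j.+1 <= m < n.+1) (Vgrad h n i m)%:Z in
  Labels al be (fun i j => al i.-1 j + be i j).

Definition sigma (n : nat) (a : vertices) : vertices :=
  vertices_of (sigma_labels n (edges a)).

(* Main.v *)
Require Import Defs.
From mathcomp Require Import all_boot all_order all_algebra.
From mathcomp Require Import perm zify ring.

(* Let f(r,i,d) be the (i,d) vertex label of H^(r).  Read U_id as the
   number of entries i in row d of a tableau.  Removing row r path by path
   then is a tandem of queues (row d serves the entries bumped out of row d+1),
   whose recursion becomes the tropical octahedron recurrence
     f(r-1,i-1,d-1) + f(r,i,d)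
       = max (f(r,i-1,d-1) + f(r-1,i,d)) (f(r-1,i,d-1) + f(r,i-1,d))
   on the tetrahedron i <= d <= r <= n.  Its face r = n is H, its face i = 0 is
   sigma H up to the partial sums of nu, and its faces i = d and d = r only
   involve lambda and nu.

   This recurrence is the degree of the same recurrence over positive rational
   functions.  After a gauge transformation the solution there is 1 on the
   faces i = d and d = r, and then it consists of the minors of a unitriangular
   matrix X on its first rows and the columns {1..i} u {d+1..r}.  By the same
   three-term Pluecker relation, the minors of X on the first rows and the
   columns {i+1..d} u {r+1..n} again solve the recurrence.  The face r = n of
   that solution, columns {i+1..d}, is sigma H, so it is the evolution of
   sigma H; and its face i = 0, columns {1..d} u {r+1..n}, is H. *)

Set Implicit Arguments.
Unset Strict Implicit.
Unset Printing Implicit Defensive.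

Import Order.TTheory GRing.Theory Num.Theory.
Local Open Scope ring_scope.

(** * Positive rational functions and their degrees *)

(* Positivity of both leading coefficients makes the degree of a sum the max of
   the degrees. *)
Definition has_degree (x : {fraction {poly rat}}) (d : int) : Prop :=
  exists p q : {poly rat},
    [/\ 0 < lead_coef p, 0 < lead_coef q, x * FracField.tofrac q = FracField.tofrac p
      & (size p)%:Z - (size q)%:Z = d].

Lemma lead_coef_gt0_neq0 (p : {poly rat}) : 0 < lead_coef p -> p != 0.
Proof. by move=> p0; rewrite -lead_coef_eq0 gt_eqF. Qed.

Lemma lead_coef_gt0_size (p : {poly rat}) : 0 < lead_coef p -> (0 < size p)%N.
Proof. by move=> p0; rewrite size_poly_gt0 lead_coef_gt0_neq0. Qed.

Lemma size_polyD_gt0 (p q : {poly rat}) : 0 < lead_coef p -> 0 < lead_coef q ->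
  0 < lead_coef (p + q) /\ size (p + q) = maxn (size p) (size q).
Proof.
move=> p0 q0; have [lt_qp|lt_pq|eq_pq] := ltngtP (size q) (size p).
- by rewrite lead_coefDl // size_polyDl.
- by rewrite lead_coefDr // addrC size_polyDl.
- have sz : (size p > 0)%N by apply: lead_coef_gt0_size.
  have cpq : 0 < (p + q)`_(size p).-1.
    by rewrite coefD; move: p0 q0; rewrite !lead_coefE eq_pq; exact: addr_gt0.
  have szpq : size (p + q) = size p.
    apply/eqP; rewrite eqn_leq (leq_trans (size_polyD _ _)) ?eq_pq ?maxnn ?leqnn //=.
    rewrite leqNgt; apply/negP => lt_sz; move: cpq; rewrite nth_default ?ltxx //.
    by move: sz lt_sz; case: (size p) => // k _; rewrite ltnS.
  by rewrite lead_coefE szpq.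
Qed.

Lemma size_polyM_gt0 (p q : {poly rat}) : 0 < lead_coef p -> 0 < lead_coef q ->
  0 < lead_coef (p * q) /\ (size (p * q))%:Z = (size p)%:Z + (size q)%:Z - 1.
Proof.
move=> p0 q0; rewrite lead_coefM mulr_gt0 //; split=> //.
rewrite size_mul ?lead_coef_gt0_neq0 //.
case: (size p) (lead_coef_gt0_size p0) => // m _.
by case: (size q) (lead_coef_gt0_size q0) => // l _; lia.
Qed.

Lemma has_degree_neq0 x d : has_degree x d -> x != 0.
Proof.
case=> p [q [p0 _ xE _]]; apply/eqP => x0; move: xE; rewrite x0 mul0r => /esym/eqP.
by rewrite tofrac_eq0 (negPf (lead_coef_gt0_neq0 p0)).
Qed.

Lemma has_degree_unique x d e : has_degree x d -> has_degree x e -> d = e.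
Proof.
case=> p [q [p0 q0 xE <-]] [p' [q' [p'0 q'0 xE' <-]]].
have : p * q' = p' * q.
  apply/eqP; rewrite -tofrac_eq !tofracM -xE -xE'; apply/eqP; ring.
move=> /(congr1 (fun s : {poly rat} => (size s)%:Z)).
by rewrite (size_polyM_gt0 p0 q'0).2 (size_polyM_gt0 p'0 q0).2; lia.
Qed.

Lemma has_degree1 : has_degree 1 0.
Proof. by exists 1, 1; rewrite lead_coef1 mul1r subrr. Qed.

Lemma has_degreeM x y d e :
  has_degree x d -> has_degree y e -> has_degree (x * y) (d + e).
Proof.
case=> p [q [p0 q0 xE <-]] [p' [q' [p'0 q'0 yE <-]]].
exists (p * p'), (q * q'); have [? ?] := size_polyM_gt0 p0 p'0.
have [? ?] := size_polyM_gt0 q0 q'0; split=> //; last by lia.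
rewrite !tofracM -xE -yE; ring.
Qed.

Lemma has_degreeV x d : has_degree x d -> has_degree x^-1 (- d).
Proof.
move=> dx; have x0 := has_degree_neq0 dx.
case: dx => p [q [p0 q0 xE <-]]; exists q, p; split=> //; last by lia.
by rewrite -xE mulrA mulVf // mul1r.
Qed.

Lemma has_degreeD x y d e :
  has_degree x d -> has_degree y e -> has_degree (x + y) (Num.max d e).
Proof.
case=> p [q [p0 q0 xE <-]] [p' [q' [p'0 q'0 yE <-]]].
have [pq'0 szpq'] := size_polyM_gt0 p0 q'0; have [p'q0 szp'q] := size_polyM_gt0 p'0 q0.
have [? szD] := size_polyD_gt0 pq'0 p'q0; have [? szqq'] := size_polyM_gt0 q0 q'0.
exists (p * q' + p' * q), (q * q'); split=> //; last first.
  by rewrite szqq' szD; move: szpq' szp'q; move: (size _) (size (p' * q)) => ? ?; lia.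
rewrite tofracD !tofracM -xE -yE; ring.
Qed.

Definition monomial (d : int) : {fraction {poly rat}} :=
  match d with
  | Posz k => FracField.tofrac 'X^k
  | Negz k => (FracField.tofrac 'X^(k.+1))^-1
  end.

Lemma has_degree_monomial d : has_degree (monomial d) d.
Proof.
have degXn k : has_degree (FracField.tofrac 'X^k) k%:Z.
  exists 'X^k, 1; rewrite lead_coefXn lead_coef1 tofrac1 mulr1; split=> //.
  by rewrite size_polyXn size_poly1 -addn1 PoszD addrK.
case: d => k; first exact: degXn.
by rewrite NegzE; apply: has_degreeV; apply: degXn.
Qed.

(** * Pluecker relations between minors on the first rows *)

Lemma det_block_mx_schur (R : comUnitRingType) m1 m2 (A : 'M[R]_m1) (B : 'M_(m1, m2))
    (C : 'M_(m2, m1)) (D : 'M_m2) : A \in unitmx ->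
  \det (block_mx A B C D) = \det A * \det (D - C *m invmx A *m B).
Proof.
move=> Au.
have -> : block_mx A B C D =
    block_mx 1%:M 0 (C *m invmx A) 1%:M *m block_mx A B 0 (D - C *m invmx A *m B).
  by rewrite mulmx_block !mul1mx !mul0mx !addr0 mulmxKV // addrC subrK.
by rewrite det_mulmx det_lblock det_ublock !det1 !mul1r.
Qed.

Lemma det_mx22 (R : comNzRingType) (M : 'M[R]_2) :
  \det M = M 0 0 * M 1 1 - M 0 1 * M 1 0.
Proof.
rewrite (expand_det_row _ 0) !big_ord_recl big_ord0 addr0 /cofactor !det_mx11 !mxE.
rewrite expr0 expr1 mul1r mulN1r mulrN.
by congr (M _ _ * M _ _ - M _ _ * M _ _); apply: val_inj.
Qed.

Section TopMinor.

Variables (F : fieldType) (X : nat -> nat -> F).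

(** The order [k] is kept apart from the list of columns, so that lists can be split and permuted
    without changing the type of a matrix. *)
Definition top_minor (k : nat) (s : seq nat) : F :=
  \det (\matrix_(i < k, j < k) X i (nth 0%N s j)).

Lemma top_minor_swap k u x y v : ((size u).+1 < k)%N ->
  top_minor k (u ++ x :: y :: v) = - top_minor k (u ++ y :: x :: v).
Proof.
move=> ltuk; have ltuk' := ltnW ltuk.
pose j1 := Ordinal ltuk'; pose j2 := Ordinal ltuk.
have -> : top_minor k (u ++ x :: y :: v) =
    \det (xcol j1 j2 (\matrix_(i < k, j < k) X i (nth 0%N (u ++ y :: x :: v) j))).
  congr (\det _); apply/matrixP => i j; rewrite !mxE; congr (X _ _).
  rewrite !nth_cat; case: tpermP => [->|->|/eqP + /eqP].
  - by rewrite /= ltnn subnn ltnNge leqnSn /= subSnn.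
  - by rewrite /= ltnn subnn ltnNge leqnSn /= subSnn.
  rewrite -!val_eqE /=; case: ltnP => // le_uj neq1 neq2.
  (* Away from the swapped positions [j] is at least [size u + 2], where both lists agree. *)
  by have -> : (j - size u = (j - size u).-2.+2)%N by lia.
rewrite xcolE det_mulmx /tperm_mx det_perm odd_tperm -val_eqE /= ltn_eqF // expr1.
by rewrite mulrN1.
Qed.

Lemma top_minor_move k u x v w : (size u + size v < k)%N ->
  top_minor k (u ++ x :: v ++ w) = (-1) ^+ size v * top_minor k (u ++ v ++ x :: w).
Proof.
elim: v u => [|y v IHv] u /= ltk; first by rewrite mul1r.
rewrite top_minor_swap; last by lia.
rewrite -cat_rcons IHv ?size_rcons; last by lia.
by rewrite cat_rcons exprS mulN1r mulNr.
Qed.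

(* Row reduction by the top rows of the columns s turns each of these minors
   into a 1 x 1 or 2 x 2 minor of the last two rows, times the minor of s. *)
Lemma top_minor_plucker s x y z : top_minor (size s) s != 0 ->
  top_minor (size s).+1 (s ++ [:: y]) * top_minor (size s).+2 (s ++ [:: x; z]) =
  top_minor (size s).+1 (s ++ [:: x]) * top_minor (size s).+2 (s ++ [:: y; z])
  + top_minor (size s).+1 (s ++ [:: z]) * top_minor (size s).+2 (s ++ [:: x; y]).
Proof.
set k := size s => s0.
pose C := \matrix_(i < k, j < k) X i (nth 0%N s j).
have Cu : C \in unitmx by rewrite unitmxE unitfE.
pose col c : 'cV_k := \col_i X i c.
pose red l c := X l c - ((\row_j X l (nth 0%N s j)) *m invmx C *m col c) 0 0.
have minor1 c : top_minor k.+1 (s ++ [:: c]) = \det C * red k c.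
  rewrite -[in LHS]addn1 /top_minor.
  pose M := block_mx C (col c) (\row_j X k (nth 0%N s j)) (X k c)%:M.
  rewrite (_ : \matrix_(i, j) _ = M); last first.
    apply/matrixP => i j; rewrite [RHS]mxE [LHS]mxE.
    case: splitP => i' ->; rewrite [RHS]mxE; case: splitP => j' ->; rewrite !mxE nth_cat.
    - by rewrite ltn_ord.
    - by rewrite ord1 addn0 ltnn subnn.
    - by rewrite ltn_ord ord1 addn0.
    - by rewrite !ord1 !addn0 ltnn subnn eqxx.
  rewrite /M det_block_mx_schur // det_mx11 [X in _ * X]mxE [X in _ * (X + _)]mxE.
  by rewrite [X in _ + X]mxE.
have minor2 c d : top_minor k.+2 (s ++ [:: c; d]) =
    \det C * (red k c * red k.+1 d - red k d * red k.+1 c).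
  rewrite -[in LHS]addn2 /top_minor.
  pose e (j : 'I_2) := nth 0%N [:: c; d] j.
  pose M := block_mx C (\matrix_(i, j) X i (e j)) (\matrix_(i < 2, j < k) X (k + i)%N (nth 0%N s j))
    (\matrix_(i < 2, j < 2) X (k + i)%N (e j)).
  rewrite (_ : \matrix_(i, j) _ = M); last first.
    apply/matrixP => i j; rewrite [RHS]mxE [LHS]mxE.
    case: splitP => i' ->; rewrite [RHS]mxE; case: splitP => j' ->; rewrite !mxE nth_cat.
    - by rewrite ltn_ord.
    - by rewrite ltnNge leq_addr /= addKn.
    - by rewrite ltn_ord.
    - by rewrite ltnNge leq_addr /= addKn.
  have redE (i j : 'I_2) : (\matrix_(i < 2, j < 2) X (k + i)%N (e j) -
     \matrix_(i < 2, j < k) X (k + i)%N (nth 0%N s j) *m invmx C *m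
     \matrix_(i < k, j < 2) X i (e j)) i j = red (k + i)%N (e j).
    rewrite !mxE /red !mxE; congr (_ - _); apply: eq_bigr => l _; rewrite !mxE.
    by congr (_ * _); apply: eq_bigr => l' _; rewrite !mxE.
  by rewrite /M det_block_mx_schur // det_mx22 !redE /= addn0 addn1.
rewrite !minor1 !minor2; ring.
Qed.

(** [top_minor_plucker] with the columns restored to the order [s1], [x], [y], [s2], [z]. Moving
    them contributes a sign to each factor, but every product gets a square. *)
Lemma top_minor_plucker_left s1 s2 x y z :
  top_minor (size (s1 ++ s2)) (s1 ++ s2) != 0 ->
  let k := size (s1 ++ s2) in
  top_minor k.+1 (s1 ++ y :: s2) * top_minor k.+2 (s1 ++ x :: s2 ++ [:: z]) =
  top_minor k.+1 (s1 ++ x :: s2) * top_minor k.+2 (s1 ++ y :: s2 ++ [:: z])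
  + top_minor k.+1 (s1 ++ s2 ++ [:: z]) * top_minor k.+2 (s1 ++ [:: x, y & s2]).
Proof.
move=> s0 k; have szk : (size s1 + size s2 < k.+1)%N by rewrite /k size_cat.
have mv1 c : top_minor k.+1 (s1 ++ c :: s2) =
    (-1) ^+ size s2 * top_minor k.+1 ((s1 ++ s2) ++ [:: c]).
  by rewrite -[in LHS](cats0 s2) top_minor_move // catA.
have mv2 c d : top_minor k.+2 (s1 ++ c :: s2 ++ [:: d]) =
    (-1) ^+ size s2 * top_minor k.+2 ((s1 ++ s2) ++ [:: c; d]).
  by rewrite top_minor_move ?catA //; lia.
have -> : top_minor k.+2 (s1 ++ [:: x, y & s2]) = top_minor k.+2 ((s1 ++ s2) ++ [:: x; y]).
  rewrite -cat_rcons -[in LHS](cats0 s2) top_minor_move ?size_rcons; last by lia.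
  by rewrite cat_rcons mv2 mulrA -exprD addnn -mul2n exprM sqrrN !expr1n mul1r.
rewrite !mv1 !mv2 !catA; have := top_minor_plucker x y z s0; rewrite -/k => pl.
have := signrMK (size s2) (1 : F); rewrite mulr1.
set e := _ ^+ size s2 => e2.
transitivity (e * e * (top_minor k.+1 ((s1 ++ s2) ++ [:: y]) *
  top_minor k.+2 ((s1 ++ s2) ++ [:: x; z]))); first by ring.
rewrite {}pl; ring : e2.
Qed.

(** The same for the order [x], [s1], [y], [z], [s2]. Apart from squares, all three products carry
    the sign of moving [x] past [s1 ++ s2]. *)
Lemma top_minor_plucker_mid s1 s2 x y z :
  top_minor (size (s1 ++ s2)) (s1 ++ s2) != 0 ->
  let k := size (s1 ++ s2) in
  top_minor k.+1 (s1 ++ y :: s2) * top_minor k.+2 (x :: s1 ++ z :: s2) =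
  top_minor k.+1 (x :: s1 ++ s2) * top_minor k.+2 (s1 ++ [:: y, z & s2])
  + top_minor k.+1 (s1 ++ z :: s2) * top_minor k.+2 (x :: s1 ++ y :: s2).
Proof.
move=> s0 k; have szk : (size s1 + size s2 < k.+1)%N by rewrite /k size_cat.
have mv1 c : top_minor k.+1 (s1 ++ c :: s2) =
    (-1) ^+ size s2 * top_minor k.+1 ((s1 ++ s2) ++ [:: c]).
  by rewrite -[in LHS](cats0 s2) top_minor_move // catA.
have mvx : top_minor k.+1 (x :: s1 ++ s2) =
    (-1) ^+ size (s1 ++ s2) * top_minor k.+1 ((s1 ++ s2) ++ [:: x]).
  by rewrite -[in LHS](cats0 (s1 ++ s2)) (@top_minor_move _ [::]).
have mv2 c : top_minor k.+2 (x :: s1 ++ c :: s2) =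
    (-1) ^+ size s2 * ((-1) ^+ size (s1 ++ s2) * top_minor k.+2 ((s1 ++ s2) ++ [:: x; c])).
  rewrite -[in LHS](cats0 s2) -cat_cons top_minor_move; last by rewrite /=; lia.
  by rewrite cat_cons catA (@top_minor_move _ [::]) //= ltnS leqnSn.
have mvyz : top_minor k.+2 (s1 ++ [:: y, z & s2]) = top_minor k.+2 ((s1 ++ s2) ++ [:: y; z]).
  rewrite -cat_rcons -[in LHS](cats0 s2) top_minor_move ?size_rcons; last by lia.
  rewrite cat_rcons top_minor_move; last by lia.
  by rewrite -catA mulrA -exprD addnn -mul2n exprM sqrrN !expr1n mul1r.
rewrite mvyz mvx !mv1 !mv2 ![LHS]mulrA; have := top_minor_plucker x y z s0.
have := signrMK (size s2) (1 : F); rewrite mulr1 => e2.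
set e := _ ^+ size s2 in e2 *; rewrite -/k => pl.
transitivity ((-1) ^+ size (s1 ++ s2) * (e * e) * (top_minor k.+1 ((s1 ++ s2) ++ [:: y]) *
  top_minor k.+2 ((s1 ++ s2) ++ [:: x; z]))); first by ring.
rewrite {}pl; ring : e2.
Qed.
End TopMinor.

(** * The octahedron recurrence *)

(* The indices are shifted by one with respect to the header, to avoid
   predecessors. *)
Definition octahedral (n : nat) (f : nat -> nat -> nat -> int) : Prop :=
  forall r i d, (i < d)%N -> (d < r)%N -> (r < n)%N ->
  f r i d + f r.+1 i.+1 d.+1 =
  Num.max (f r.+1 i d + f r i.+1 d.+1) (f r i.+1 d + f r.+1 i d.+1).

Definition mul_octahedral (F : fieldType) (n : nat) (g : nat -> nat -> nat -> F) : Prop :=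
  forall r i d, (i < d)%N -> (d < r)%N -> (r < n)%N ->
  g r i d * g r.+1 i.+1 d.+1 =
  g r.+1 i d * g r i.+1 d.+1 + g r i.+1 d * g r.+1 i d.+1.

(** * Lifting a max-plus solution to positive rational functions *)

Section Lift.

Variables (n : nat) (f : nat -> nat -> nat -> int).

(* Along the recursion 2n - r - i decreases, so it can serve as fuel. *)
Fixpoint lift_fuel (m r i d : nat) : {fraction {poly rat}} :=
  if (i == d) || (d == r) then 1 else
  if r == n then monomial (f n i d) else
  if m is m'.+1 then
    (lift_fuel m' r.+1 i d * lift_fuel m' r i.+1 d.+1
     + lift_fuel m' r i.+1 d * lift_fuel m' r.+1 i d.+1)
    / lift_fuel m'.-1 r.+1 i.+1 d.+1
  else 1.

Definition octahedral_lift (r i d : nat) := lift_fuel (2 * n - r - i) r i d.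

Lemma octahedral_lift_left r i : octahedral_lift r i i = 1.
Proof. by rewrite /octahedral_lift; case: (_ - _)%N => [|m] /=; rewrite eqxx. Qed.

Lemma octahedral_lift_right r i : octahedral_lift r i r = 1.
Proof. by rewrite /octahedral_lift; case: (_ - _)%N => [|m] /=; rewrite eqxx orbT. Qed.

Lemma octahedral_liftE r i d : (i < d)%N -> (d < r)%N -> (r < n)%N ->
  octahedral_lift r i d =
  (octahedral_lift r.+1 i d * octahedral_lift r i.+1 d.+1
   + octahedral_lift r i.+1 d * octahedral_lift r.+1 i d.+1)
  / octahedral_lift r.+1 i.+1 d.+1.
Proof.
move=> id dr rn; rewrite {1}/octahedral_lift.
have -> : (2 * n - r - i = (2 * n - r.+1 - i).+1)%N by lia.
rewrite /= (ltn_eqF id) (ltn_eqF dr) (ltn_eqF rn) /= /octahedral_lift.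
have -> : (2 * n - r - i.+1 = 2 * n - r.+1 - i)%N by lia.
by have -> : ((2 * n - r.+1 - i).-1 = 2 * n - r.+1 - i.+1)%N by lia.
Qed.

Hypothesis f_left : forall r i, (i <= r)%N -> (r <= n)%N -> f r i i = 0.
Hypothesis f_right : forall r i, (i <= r)%N -> (r <= n)%N -> f r i r = 0.
Hypothesis f_oct : octahedral n f.

(** The recurrence for the lift has no subtraction, so degrees turn its sums, products and quotients
    into the maxima, sums and differences of [f_oct]. *)
Lemma has_degree_octahedral_lift r i d : (i <= d)%N -> (d <= r)%N -> (r <= n)%N ->
  has_degree (octahedral_lift r i d) (f r i d).
Proof.
have [m] := ubnP (2 * n - r - i); elim: m r i d => // m IHm r i d ltm.
rewrite leq_eqVlt => /predU1P[<-{d} ir rn|id].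
  by rewrite octahedral_lift_left f_left //; exact: has_degree1.
rewrite leq_eqVlt => /predU1P[<-{r ltm} rn|dr].
  by rewrite octahedral_lift_right (f_right (ltnW id) rn); exact: has_degree1.
rewrite leq_eqVlt => /predU1P[rn|rn].
  rewrite /octahedral_lift rn; case: (_ - _)%N => [|m'] /=;
    rewrite (ltn_eqF id) -rn (ltn_eqF dr) eqxx /=; exact: has_degree_monomial.
rewrite octahedral_liftE //.
have -> : f r i d = Num.max (f r.+1 i d + f r i.+1 d.+1) (f r i.+1 d + f r.+1 i d.+1)
    + - f r.+1 i.+1 d.+1 by rewrite -f_oct // addrK.
apply: has_degreeM; last by apply/has_degreeV/IHm; lia.
by apply: has_degreeD; apply: has_degreeM; apply: IHm; lia.
Qed.

Lemma mul_octahedral_lift : mul_octahedral n octahedral_lift.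
Proof.
move=> r i d id dr rn; rewrite octahedral_liftE // divfK //.
by apply: has_degree_neq0 (has_degree_octahedral_lift _ _ _); lia.
Qed.

End Lift.

(** * Solutions as minors of a unitriangular matrix *)

Section SolidMinors.

Variables (F : fieldType) (n : nat) (g : nat -> nat -> nat -> F).
Hypothesis g_neq0 : forall r i d, (i <= d)%N -> (d <= r)%N -> (r <= n)%N -> g r i d != 0.
Hypothesis g_left : forall r i, (i <= r)%N -> (r <= n)%N -> g r i i = 1.
Hypothesis g_right : forall r i, (i <= r)%N -> (r <= n)%N -> g r i r = 1.
Hypothesis g_oct : mul_octahedral n g.

(** The entries are forced by the columns 0, ..., i-1, j: that minor is upper triangular with
    diagonal 1, ..., 1, [X i j] (see [top_minor_initial1]). *)
Definition unitriangular_of (i j : nat) : F := if (i <= j)%N then g j.+1 i j else 0.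

(* Columns are numbered from 0: the half-open intervals [a, b) and [c, d). *)
Definition two_intervals (a b c d : nat) : seq nat := iota a (b - a) ++ iota c (d - c).

Lemma det_utrig k (A : 'M[F]_k) :
  (forall i j : 'I_k, (j < i)%N -> A i j = 0) -> \det A = \prod_(i < k) A i i.
Proof.
move=> A0; rewrite -det_tr det_trig; first by apply: eq_bigr => i _; rewrite mxE.
by apply/is_trig_mxP => i j ij; rewrite mxE A0.
Qed.

Lemma top_minor_initial k : (k <= n)%N ->
  top_minor unitriangular_of k (iota 0 k) = 1.
Proof.
move=> kn; rewrite /top_minor det_utrig => [|i j ji]; last first.
  by rewrite mxE nth_iota // /unitriangular_of leqNgt ji.
apply: big1 => i _; rewrite mxE nth_iota // /unitriangular_of leqnn g_left //.
exact: leq_trans (ltn_ord i) kn.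
Qed.

Lemma top_minor_initial1 i j : (i <= j)%N -> (j < n)%N ->
  top_minor unitriangular_of i.+1 (rcons (iota 0 i) j) = g j.+1 i j.
Proof.
move=> ij jn; have nth_lt (l : nat) : (l < i)%N -> nth 0%N (rcons (iota 0 i) j) l = l.
  by move=> li; rewrite nth_rcons size_iota li nth_iota.
rewrite /top_minor det_utrig => [|l m ml]; last first.
  rewrite mxE nth_lt; first by rewrite /unitriangular_of leqNgt ml.
  by have := ltn_ord l; lia.
rewrite big_ord_recr /= big1 => [|l _]; rewrite mxE /=.
  by rewrite nth_rcons size_iota ltnn eqxx mul1r /unitriangular_of ij.
rewrite nth_lt // /unitriangular_of leqnn g_left //.
by have := ltn_ord l; lia.
Qed.

Lemma two_intervals_nilr a b c : two_intervals a b c c = iota a (b - a).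
Proof. by rewrite /two_intervals subnn cats0. Qed.

Lemma two_intervals_nill a c d : two_intervals a a c d = iota c (d - c).
Proof. by rewrite /two_intervals subnn. Qed.

Lemma two_intervals_join a b d : (a <= b)%N -> (b <= d)%N ->
  two_intervals a b b d = iota a (d - a).
Proof.
move=> ab bd; rewrite /two_intervals (_ : d - a = (b - a) + (d - b))%N; last by lia.
by rewrite iotaD subnKC.
Qed.

Lemma size_two_intervals a b c d : size (two_intervals a b c d) = (b - a + (d - c))%N.
Proof. by rewrite size_cat !size_iota. Qed.

Lemma iota_recr a b : (a <= b)%N -> iota a (b.+1 - a) = rcons (iota a (b - a)) b.
Proof. by move=> ab; rewrite subSn // -addn1 iotaD cats1 subnKC. Qed.

Lemma iota_recl a b : (a < b)%N -> iota a (b - a) = a :: iota a.+1 (b - a.+1).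
Proof. by move=> ab; rewrite -(subnSK ab). Qed.

(** Induction on [r - d]: the Pluecker relation and [g_oct] have the same shape, and they express
    the minor with the widest gap through five narrower ones. *)
Lemma top_minor_solid r i d : (i <= d)%N -> (d <= r)%N -> (r <= n)%N ->
  top_minor unitriangular_of (i + (r - d)) (two_intervals 0 i d r) = g r i d.
Proof.
have [m] := ubnP (r - d); elim: m r i d => // m IHm r i d ltm.
rewrite leq_eqVlt => /predU1P[<-{d ltm} ir rn|id].
  by rewrite two_intervals_join // subn0 subnKC // top_minor_initial // g_left.
rewrite leq_eqVlt => /predU1P[<-{r ltm} dn|dr rn].
  by rewrite two_intervals_nilr subnn subn0 addn0 top_minor_initial ?g_right //; lia.
case: r dr rn ltm => // r; rewrite ltnS leq_eqVlt => /predU1P[<-{r} dn _|dr rn ltm].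
  rewrite /two_intervals subSnn addn1 subn0 cats1 top_minor_initial1 //; exact: ltnW.
(* These are the columns common to all six minors. *)
have neq0 : top_minor unitriangular_of (i + (r - d.+1)) (two_intervals 0 i d.+1 r) != 0.
  by rewrite IHm ?g_neq0; lia.
have sz : size (two_intervals 0 i d.+1 r) = (i + (r - d.+1))%N.
  by rewrite size_two_intervals subn0.
have := @top_minor_plucker_left _ unitriangular_of (iota 0 (i - 0)) (iota d.+1 (r - d.+1)) i d r.
rewrite -/(two_intervals 0 i d.+1 r) sz => /(_ neq0).
rewrite !cats1 -(iota_recr dr) -(iota_recl dr) -(iota_recl (leqW dr)).
rewrite -!(cat_rcons i) -(iota_recr (leq0n i)) -!/(two_intervals _ _ _ _) /=.
have -> : (i + (r - d.+1)).+2 = (i + (r.+1 - d))%N by lia.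
have -> : (i + (r - d.+1)).+1 = (i + (r - d))%N by lia.
have IH r' i' d' : (i' <= d')%N -> (d' <= r')%N -> (r' <= r.+1)%N -> (r' - d' < r.+1 - d)%N ->
    forall k, k = (i' + (r' - d'))%N ->
    top_minor unitriangular_of k (two_intervals 0 i' d' r') = g r' i' d'.
  by move=> *; subst; apply: IHm; lia.
(* Only this minor is outside the reach of [IH]. It is determined because its cofactor
   [g r i.+1 d.+1] is nonzero. *)
set target := top_minor _ (i + _)%N (two_intervals 0 i d r.+1).
do ![rewrite IH; try by lia]; rewrite g_oct // mulrC [g r i.+1 d * _]mulrC => /addIr.
by move=> /mulfI-> //; rewrite g_neq0 //; lia.
Qed.

Definition tail_minor r i d : F :=
  top_minor unitriangular_of ((d - i) + (n - r)) (two_intervals i d r n).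

(** On each of the four faces treated here the columns again have the form of [top_minor_solid]. The
    face r = n becomes the face i = 0 of [g], and conversely: this is the exchange behind the
    involution. *)
Lemma tail_minor_left r i : (r <= n)%N -> tail_minor r i i = g n 0 r.
Proof.
move=> rn; by rewrite /tail_minor two_intervals_nill subnn -top_minor_solid.
Qed.

Lemma tail_minor_right r i : (i <= r)%N -> (r <= n)%N -> tail_minor r i r = g n 0 i.
Proof.
move=> ir rn; rewrite /tail_minor two_intervals_join // -top_minor_solid ?(leq_trans ir) //.
by rewrite two_intervals_nill; congr top_minor; lia.
Qed.

Lemma tail_minor_top i d : (i <= d)%N -> (d <= n)%N -> tail_minor n i d = g d 0 i.
Proof.
move=> id dn; by rewrite /tail_minor two_intervals_nilr subnn addn0 -top_minor_solid.
Qed.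

Lemma tail_minor_first d r : (d <= r)%N -> (r <= n)%N -> tail_minor r 0 d = g n d r.
Proof. by move=> dr rn; rewrite /tail_minor subn0 top_minor_solid. Qed.

(** The nonvanishing minor is on the columns common to all six; when the lemma is applied, its
    degree is already known by induction. *)
Lemma tail_minor_oct r i d : (i < d)%N -> (d < r)%N -> (r < n)%N ->
  tail_minor r.+1 i.+1 d != 0 ->
  tail_minor r i d * tail_minor r.+1 i.+1 d.+1 =
  tail_minor r.+1 i d * tail_minor r i.+1 d.+1 + tail_minor r i.+1 d * tail_minor r.+1 i d.+1.
Proof.
move=> id dr rn neq0.
have := @top_minor_plucker_mid _ unitriangular_of
  (iota i.+1 (d - i.+1)) (iota r.+1 (n - r.+1)) i d r.
rewrite -/(two_intervals _ _ _ _) size_two_intervals => /(_ neq0).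
rewrite -(iota_recl rn) -!(cat_rcons d) -!iota_recr // -!cat_cons -(iota_recl id).
rewrite -(iota_recl (leqW id)) -!/(two_intervals _ _ _ _) /=.
set k := (d - i.+1 + (n - r.+1))%N => pl.
rewrite /tail_minor !subSS.
have -> : (d - i + (n - r) = k.+2)%N by rewrite /k; lia.
have -> : (d - i + (n - r.+1) = k.+1)%N by rewrite /k; lia.
have -> : (d - i.+1 + (n - r) = k.+1)%N by rewrite /k; lia.
have -> : (d.+1 - i + (n - r.+1) = k.+2)%N by rewrite /k; lia.
by rewrite mulrC.
Qed.

End SolidMinors.

(** For vertex labels [f r] of the successive hives, the two middle clauses say that the lower
    boundary stays lambda_1, ..., lambda_r and the right boundary nu_1, ..., nu_r. The clauses
    together determine [f]. *)
Definition growth (n : nat) (a : nat -> nat -> int) (f : nat -> nat -> nat -> int) : Prop :=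
  [/\ forall i d, (i <= d)%N -> (d <= n)%N -> f n i d = a i d,
      forall r i, (i <= r)%N -> (r <= n)%N -> f r i i = a i i,
      forall r i, (i <= r)%N -> (r <= n)%N -> f r i r = a r r - a r n + a i n
    & octahedral n f].

Lemma growth_swap_inv n a b f f' :
  growth n a f -> growth n b f' ->
  (forall i j, (i <= j)%N -> (j <= n)%N -> b i j = f j 0 i + a j n - a 0 n) ->
  forall r d, (d <= r)%N -> (r <= n)%N -> f' r 0 d + b r n - b 0 n = a d r.
Proof.
move=> [f_top f_left f_right f_oct] [f'_top f'_left f'_right f'_oct] bE.
(* The gauge: terms in [i] alone or [d] alone cancel from the recurrence, and these make the faces i
   = d and d = r vanish. *)
pose h r i d := f r i d - a d d + a d n - a i n.
have h_left r i : (i <= r)%N -> (r <= n)%N -> h r i i = 0.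
  by move=> ir rn; rewrite /h f_left //; lia.
have h_right r i : (i <= r)%N -> (r <= n)%N -> h r i r = 0.
  by move=> ir rn; rewrite /h f_right //; lia.
have h_oct : octahedral n h.
  by move=> r i d id dr rn; have := f_oct _ _ _ id dr rn; rewrite /h; lia.
pose g := octahedral_lift n h.
have deg_g r i d : (i <= d)%N -> (d <= r)%N -> (r <= n)%N -> has_degree (g r i d) (h r i d).
  exact: has_degree_octahedral_lift.
have g_neq0 r i d : (i <= d)%N -> (d <= r)%N -> (r <= n)%N -> g r i d != 0.
  by move=> id dr rn; apply: has_degree_neq0 (deg_g _ _ _ id dr rn).
have g_left r i : (i <= r)%N -> (r <= n)%N -> g r i i = 1.
  by move=> _ _; exact: octahedral_lift_left.
have g_right r i : (i <= r)%N -> (r <= n)%N -> g r i r = 1.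
  by move=> _ _; exact: octahedral_lift_right.
have g_oct : mul_octahedral n g by exact: mul_octahedral_lift.
(* The degrees of the tail minors are [f'] in another gauge, with terms in [r], [i] and [d] alone.
   The three boundary faces are compared through [bE]. *)
have deg_tail r i d : (i <= d)%N -> (d <= r)%N -> (r <= n)%N ->
    has_degree (tail_minor n g r i d)
      (f' r i d - a d n + a i n - a i i - (a r r - a 0 r - a r n + a 0 n)).
  have [m] := ubnP (2 * n - r - i); elim: m r i d => // m IHm r i d ltm.
  rewrite leq_eqVlt => /predU1P[<-{d} ir rn|id].
    rewrite tail_minor_left //; have := deg_g n 0 r (leq0n _) rn (leqnn _).
    congr has_degree; rewrite /h f_top // f'_left // bE //; last by lia.
    by rewrite f_right //; lia.
  rewrite leq_eqVlt => /predU1P[<-{r ltm} rn|dr].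
    rewrite tail_minor_right // 1?ltnW //; have := deg_g n 0 i (leq0n _).
    move/(_ (ltnW (leq_trans id rn)) (leqnn _)).
    congr has_degree; rewrite /h f'_right // 1?ltnW // !bE // ?f_top //; try lia.
    by rewrite !f_right //; lia.
  rewrite leq_eqVlt => /predU1P[rn|rn].
    subst r; rewrite tail_minor_top // 1?ltnW //.
    have := deg_g d 0 i (leq0n _) (ltnW id) (ltnW dr).
    by congr has_degree; rewrite /h f'_top // 1?ltnW // bE //; lia.
  have deg1 := IHm r.+1 i.+1 d.+1 ltac:(lia) ltac:(lia) ltac:(lia) ltac:(lia).
  have deg2 := IHm r.+1 i d ltac:(lia) ltac:(lia) ltac:(lia) ltac:(lia).
  have deg3 := IHm r i.+1 d.+1 ltac:(lia) ltac:(lia) ltac:(lia) ltac:(lia).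
  have deg4 := IHm r i.+1 d ltac:(lia) ltac:(lia) ltac:(lia) ltac:(lia).
  have deg5 := IHm r.+1 i d.+1 ltac:(lia) ltac:(lia) ltac:(lia) ltac:(lia).
  have deg6 := IHm r.+1 i.+1 d ltac:(lia) ltac:(lia) ltac:(lia) ltac:(lia).
  have := tail_minor_oct id dr rn (has_degree_neq0 deg6).
  move/(canRL (mulfK (has_degree_neq0 deg1))) => ->.
  have := has_degreeM (has_degreeD (has_degreeM deg2 deg3) (has_degreeM deg4 deg5))
    (has_degreeV deg1).
  by congr has_degree; have := f'_oct _ _ _ id dr rn; lia.
(* On the face i = 0 the same minor is [g n d r], whose degree [h n d r] is [a d r] up to gauge. *)
move=> r d dr rn; have := deg_tail r 0 d (leq0n _) dr rn.
rewrite tail_minor_first // => deg_f'.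
have := has_degree_unique deg_f' (deg_g n d r dr rn (leqnn _)).
by rewrite /h f_top // !bE // !f_top //; lia.
Qed.

(** * Path removals as a tandem of queues *)

(** Serves both [next_row] and [level], where the value 0 encodes an empty set of candidates. *)
Lemma bigmax_nat_spec (P : pred nat) m (M := (\max_(1 <= i < m | P i) i)%N) :
  ((M == 0%N) || [&& 0 < M, M < m & P M]%N) /\
  (forall i, (0 < i)%N -> (i < m)%N -> P i -> (i <= M)%N).
Proof.
rewrite {}/M; split; last first.
  move=> i i0 im Pi; apply: (@leq_bigmax_seq _ _ _ (fun i => i)) => //.
  by rewrite mem_index_iota i0.
case: m => [|m]; first by rewrite big_geq.
elim: m => [|m IHm]; first by rewrite big_geq.
rewrite big_mkcond big_nat_recr //= -big_mkcond /=.
case Pm: (P m.+1); last first.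
  rewrite maxn0; case/orP: IHm => [->//|/and3P[-> lt ->]]; rewrite (ltn_trans lt) ?orbT //.
set M := bigop.body _ _ _ in IHm *.
suff -> : maxn M m.+1 = m.+1 by rewrite Pm ltnSn.
by apply/maxn_idPr; case/orP: IHm => [/eqP->//|/and3P[_ /ltnW]].
Qed.

Section Path.

Variables (r : nat) (h : labels).
Local Notation p := (path_row h r).

Lemma path_row_last : p r.+1 = r.
Proof. by rewrite /path_row subnn. Qed.

Lemma path_rowE d : (d <= r)%N -> p d = next_row h d (p d.+1).
Proof.
by move=> dr; rewrite /path_row subSn //= subKn // subSS.
Qed.

Lemma path_row_spec d : (d <= r)%N ->
  ((p d == 0%N) || [&& (0 < p d)%N, (p d < p d.+1)%N & 0 < Ugrad h (p d) d]) /\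
  (forall i, (p d < i)%N -> (i < p d.+1)%N -> Ugrad h i d <= 0).
Proof.
move=> dr; rewrite path_rowE //.
have [p0 pmax] := bigmax_nat_spec (fun i => 0 < Ugrad h i d) (p d.+1); split=> //.
move=> i lt_pi lt_ip; rewrite leNgt; apply/negP => /(pmax _ _ lt_ip).
by rewrite (leq_ltn_trans _ lt_pi) // leqNgt lt_pi => /(_ isT).
Qed.

Lemma path_row_homo d : (d <= r)%N -> (p d <= p d.+1)%N.
Proof. by case/path_row_spec => /orP[/eqP->//|/and3P[_ /ltnW]]. Qed.

Lemma path_row_ltn d : (0 < d)%N -> (d <= r)%N -> (p d < d)%N.
Proof.
move=> d0 dr; have [m] := ubnP (r - d); elim: m d d0 dr => // m IHm d d0 dr ltm.
have le_pd : (p d.+1 <= d)%N.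
  have [->|neq] := eqVneq d r; first by rewrite path_row_last.
  by rewrite -ltnS; apply: IHm; lia.
by case: (path_row_spec dr) => /orP[/eqP->//|/and3P[_ lt_p _] _]; exact: leq_trans lt_p le_pd.
Qed.

Lemma path_row_leq d e : (d <= e)%N -> (e <= r.+1)%N -> (p d <= p e)%N.
Proof.
move=> de; elim: e de => [|e IHe]; first by rewrite leqn0 => /eqP->.
rewrite leq_eqVlt => /predU1P[->//|]; rewrite ltnS => de er.
by apply: leq_trans (IHe de (leqW er)) _; exact: path_row_homo.
Qed.

(** Path rows weakly decrease as [d] decreases, so once 0 is reached the path stays there. *)
Lemma leq_level d : (0 < d)%N -> (d <= r)%N -> (d <= level h r)%N = (p d == 0%N).
Proof.
move=> d0 dr.
have [/orP lvl0 lvl_max] := bigmax_nat_spec (fun d => p d == 0%N) r.+1.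
apply/idP/idP => [dl|pd0]; last exact: lvl_max.
case: lvl0 => [/eqP l0|/and3P[_ lr /eqP pl0]].
  by move: dl; rewrite /level l0 leqn0 => /eqP d00; rewrite d00 in d0.
by rewrite -leqn0 -[X in (_ <= X)%N]pl0 path_row_leq // ltnW.
Qed.

Lemma level_leq : (level h r <= r)%N.
Proof.
have [/orP[/eqP l0|/and3P[_ lr _]] _] := bigmax_nat_spec (fun d => p d == 0%N) r.+1.
  by rewrite /level l0.
exact: lr.
Qed.

(** Splitting the interval indicator into two one-sided ones eliminates the level: below it both
    path rows are 0. *)
Lemma alpha_phi i j : (0 < j)%N -> (j <= r)%N ->
  alpha (phi r h) i j = alpha h i j - (i < p j.+1)%N%:R + (i < p j)%N%:R.
Proof.
move=> j0 jr /=; rewrite jr andbT -addrA; congr (_ + _).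
have := path_row_homo jr; case: (leqP (level h r) j) => [lj|lj _].
  by case: (ltnP i (p j)); case: (ltnP i (p j.+1)) => /=; lia.
have -> : p j.+1 = 0%N by apply/eqP; rewrite -leq_level // (leq_trans lj level_leq).
have -> // : p j = 0%N by apply/eqP; rewrite -leq_level // ltnW.
Qed.

(** In the tableau reading, the entry [p j.+1] enters row [j] and bumps out [p j], the largest
    smaller entry; nothing leaves if [p j = 0]. *)
Lemma Ugrad_phi i j : (0 < i)%N -> (0 < j)%N -> (j <= r)%N ->
  Ugrad (phi r h) i j = Ugrad h i j + (i == p j.+1)%:R - (i == p j)%:R.
Proof.
move=> i0 j0 jr; rewrite /Ugrad !alpha_phi //.
have ltn_pred (m : nat) : (i.-1 < m)%N%:R = (i < m)%N%:R + (i == m)%:R :> int.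
  by have := ltn_predK i0; case: ltngtP => /=; case: ltnP => //=; lia.
by rewrite !ltn_pred; lia.
Qed.

Lemma gamma_phi j : (0 < j)%N -> (j < r)%N -> gamma (phi r h) j j = gamma h j j.
Proof.
move=> j0 jr /=; have pj : (p j.+1 <= j)%N by rewrite -ltnS path_row_ltn.
by rewrite (ltn_eqF jr) /= subr0 [(j < p j.+1)%N]ltnNge pj !andbF subr0.
Qed.

Lemma beta_phi j : (0 < j)%N -> (j < r)%N ->
  beta (phi r h) j j = beta h j j + (j == p j.+1)%:R.
Proof.
move=> j0 jr /=; rewrite jr andbT; congr (_ + _%:R).
case: eqP => [pj|]; last by rewrite andbF.
by rewrite andbT ltnNge leq_level // -pj -lt0n j0.
Qed.

(** Summed over all paths, this makes the count at level [d] the difference of the numbers of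
    entries leaving rows [d.+1] and [d]. *)
Lemma level_eq d : (0 < d)%N -> (d < r)%N ->
  (level h r == d)%:R = (0 < p d.+1)%N%:R - (0 < p d)%N%:R :> int.
Proof.
move=> d0 dr; have := leq_level d0 (ltnW dr); have := leq_level (ltn0Sn d) dr.
have := path_row_homo (ltnW dr); move: (p d) (p d.+1) => x y.
by case: (ltngtP (level h r) d); case: (ltngtP d.+1 (level h r)); case: x; case: y => //=; lia.
Qed.

End Path.

(* Z d i is the number of entries greater than i that leave row d when the
   whole r-th row is removed, where row d contains x i d entries equal to i. *)
Definition queue (r : nat) (x : nat -> nat -> int) (Z : nat -> nat -> int) : Prop :=
  [/\ forall d, (d < r)%N -> Z d.+1 d = 0,
      forall i, (i.+1 < r)%N -> Z r i = Z r i.+1 + x i.+1 r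
    & forall i d, (i.+1 < d)%N -> (d < r)%N ->
        Z d i = Num.min (Z d.+1 i.+1) (Z d i.+1 + x i.+1 d)].

Section Queue.

Variables (r : nat) (x Z : nat -> nat -> int).
Hypothesis x_ge0 : forall i d, (0 < i)%N -> (i < d)%N -> (d <= r)%N -> 0 <= x i d.
Hypothesis Zq : queue r x Z.

Lemma queue_ge0 d i : (i < d)%N -> (d <= r)%N -> 0 <= Z d i.
Proof.
case: Zq => Z0 Zr Zd; have [m] := ubnP (r - d); elim: m d i => // m IHm d i ltm.
have [l] := ubnP (d - i); elim: l i => // l IHl i ltl.
rewrite leq_eqVlt => /predU1P[<-|id dr]; first by move=> ir; rewrite Z0.
have := IHl i.+1 ltac:(lia) id dr; have := x_ge0 (ltn0Sn i) id dr.
move: dr; rewrite leq_eqVlt => /predU1P[dr|dr]; first by subst d; rewrite (Zr i) //; lia.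
by rewrite (Zd i d) //; have := IHm d.+1 i.+1 ltac:(lia) ltac:(lia) dr; lia.
Qed.

Lemma queue_homo d : (d <= r)%N ->
  (forall i, (i.+1 < d)%N -> Z d i.+1 <= Z d i) /\
  (forall i, (i.+1 < d)%N -> (d < r)%N -> Z d i.+1 <= Z d.+1 i.+1).
Proof.
case: Zq => Z0 Zr Zd; have [m] := ubnP (r - d); elim: m d => // m IHm d ltm.
rewrite leq_eqVlt => /predU1P[->|dr].
  split=> i ir; last by rewrite ltnn.
  by rewrite (Zr i) // lerDl; apply: x_ge0.
have [homoS _] := IHm d.+1 ltac:(lia) dr.
have homo2 i : (i.+1 < d)%N -> Z d i.+1 <= Z d.+1 i.+1.
  move=> id; have [lt_id|le_di] := ltnP i.+2 d.
    by have := homoS i.+1 (leqW lt_id); rewrite (Zd i.+1 d) //; lia.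
  have -> : i.+1 = d.-1 by lia.
  have := Z0 d.-1; rewrite (ltn_predK id) => -> //; last by lia.
  by apply: queue_ge0; lia.
split=> i id; last by move=> _; exact: homo2.
have := homo2 _ id; have := x_ge0 (ltn0Sn i) id (ltnW dr); rewrite (Zd i d) //; lia.
Qed.

End Queue.

Section Step.

Variables (r : nat) (h : labels).
Hypothesis U_ge0 : forall i d, (0 < i)%N -> (i < d)%N -> (d <= r)%N -> 0 <= Ugrad h i d.
Local Notation p := (path_row h r).

Lemma Ugrad_phi_ge0 i d : (0 < i)%N -> (i < d)%N -> (d <= r)%N -> 0 <= Ugrad (phi r h) i d.
Proof.
move=> i0 id dr; have d0 := leq_ltn_trans (leq0n _) id.
have := U_ge0 i0 id dr; rewrite Ugrad_phi //.
case: (i =P p d) => [ip|_]; last by case: eqP; lia.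
have [+ _] := path_row_spec h dr; rewrite -ip (gtn_eqF i0) => /and3P[_ _ U0].
by case: eqP; lia.
Qed.

Variable Z : nat -> nat -> int.
Hypothesis Zq : queue r (Ugrad (phi r h)) Z.

(* Later paths leave row d with entries at most that of the first path. *)
Lemma queue_phi_eq0 d i : (p d <= i)%N -> (i < d)%N -> (d <= r)%N -> Z d i = 0.
Proof.
case: (Zq) => Z0 Zr Zd; have [m] := ubnP (r - d); elim: m d i => // m IHm d i ltm.
have [l] := ubnP (d - i); elim: l i => // l IHl i ltl pi.
rewrite leq_eqVlt => /predU1P[<-|id dr]; first by move=> ir; rewrite Z0.
have d0 := leq_ltn_trans (leq0n _) id.
have ZS : Z d i.+1 = 0 by apply: IHl; lia.
have U0 : (i.+1 < p d.+1)%N -> Ugrad (phi r h) i.+1 d = 0.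
  move=> ip; have := (path_row_spec h dr).2 i.+1 pi ip.
  have := U_ge0 (ltn0Sn i) id dr; rewrite Ugrad_phi // (ltn_eqF ip).
  rewrite (gtn_eqF (pi : (p d < i.+1)%N)); lia.
have U0' := Ugrad_phi_ge0 (ltn0Sn i) id dr.
move: dr; rewrite leq_eqVlt => /predU1P[dr|dr].
  by subst d; rewrite (Zr i) // ZS U0 ?path_row_last.
rewrite (Zd i d) // ZS add0r; case: (ltnP i.+1 (p d.+1)) => [ip|ip].
  have := queue_ge0 Ugrad_phi_ge0 Zq (leqW id) dr; rewrite U0 //; lia.
by rewrite (IHm d.+1 i.+1) //; lia.
Qed.

(** If [i.+1 <= p d], both terms of the minimum grow by 1, as does the left side. If [i.+1] is
    strictly between [p d] and [p d.+1], row [d] has no entry [i.+1], and monotonicity makes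
    [Z d i.+1] the minimum before and after. If [p d.+1 <= i.+1], then [Z d.+1 i.+1 = 0] and both
    minima are 0. *)
Lemma queue_phi : queue r (Ugrad h) (fun d i => Z d i + (i < p d)%N%:R).
Proof.
case: (Zq) => Z0 Zr Zd; split=> [d dr|i ir|i d id dr].
- by rewrite Z0 // ltnNge -ltnS path_row_ltn.
- have r0 := ltn_trans (ltn0Sn i) ir; rewrite (Zr i) // Ugrad_phi // path_row_last (ltn_eqF ir).
  by case: (ltngtP i.+1 (p r)); case: (ltnP i (p r)); lia.
have d0 := ltn_trans (ltn0Sn i) id.
have ge0 := Ugrad_phi_ge0 (ltn0Sn i) id (ltnW dr).
have U_ge := U_ge0 (ltn0Sn i) id (ltnW dr).
have [_ homo2] := queue_homo Ugrad_phi_ge0 Zq (ltnW dr).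
have := homo2 i id dr => {homo2} le_Z.
have Z_ge := queue_ge0 Ugrad_phi_ge0 Zq id (ltnW dr).
have ZS0 : (p d.+1 <= i.+1)%N -> Z d.+1 i.+1 = 0.
  by move=> pi; apply: queue_phi_eq0 => //; exact: leqW.
have [pd U_le] := path_row_spec h (ltnW dr); have {}U_le := U_le i.+1.
have p_homo := path_row_homo h (ltnW dr).
rewrite (Zd i d) //; move: ge0; rewrite (Ugrad_phi h (ltn0Sn i) d0 (ltnW dr)).
case: (ltngtP i.+1 (p d)) pd U_le => [lt1|gt1|eq1].
- case/orP => [/eqP pd0|/and3P[_ ltp _] _]; first by rewrite pd0 in lt1.
  have -> : (i.+1 < p d.+1)%N by lia.
  have /negPf-> : (i.+1 != p d.+1) by lia.
  by lia.
- move=> _ U_le; case: (ltngtP i.+1 (p d.+1)) => [lt2|gt2|eq2].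
  + have := U_le isT lt2; lia.
  + by rewrite ZS0 ?(ltnW gt2) //; lia.
  + by rewrite ZS0 ?(eq_leq (esym eq2)) //; lia.
- case/orP => [/eqP pd0|/and3P[_ ltp _] _]; first by rewrite pd0 in eq1.
  have -> : (i.+1 < p d.+1)%N by lia.
  have /negPf-> : (i.+1 != p d.+1) by lia.
  by lia.
Qed.

End Step.

Definition nonneg_U (r : nat) (h : labels) : Prop :=
  forall i d, (0 < i)%N -> (i < d)%N -> (d <= r)%N -> 0 <= Ugrad h i d.

Definition diag_triangle (r : nat) (h : labels) : Prop :=
  forall j, (0 < j)%N -> (j <= r)%N -> gamma h j j = alpha h j.-1 j + beta h j j.

(** The last clause is [alpha_phi] summed over all removed paths. Only diagonals below [r] occur,
    since [kappa] deletes the [r]-th. *)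
Definition row_removed (r : nat) (h h' : labels) (Z : nat -> nat -> int) : Prop :=
  [/\ nonneg_U r.-1 h', diag_triangle r.-1 h',
      forall j, (0 < j)%N -> (j < r)%N -> gamma h' j j = gamma h j j
    & forall i j, (i < j)%N -> (j < r)%N -> alpha h' i j = alpha h i j - Z j.+1 i + Z j i].

Lemma alpha_homo r h i j : nonneg_U r h -> (i <= j)%N -> (j < r)%N ->
  alpha h i r <= alpha h j r.
Proof.
move=> Uge0; elim: j => [|j IHj]; first by rewrite leqn0 => /eqP->.
rewrite leq_eqVlt => /predU1P[->//|ij] jr; apply: le_trans (IHj ij (ltnW jr)) _.
by rewrite -subr_ge0; exact: Uge0.
Qed.

Lemma alpha_const r h i j : nonneg_U r h -> alpha h r.-1 r <= alpha h 0 r ->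
  (i <= j)%N -> (j < r)%N -> alpha h j r = alpha h i r.
Proof.
move=> Uge0 le_r ij jr; apply/eqP; rewrite eq_le (alpha_homo Uge0 ij jr) andbT.
apply: le_trans (alpha_homo Uge0 (leq0n i) (leq_ltn_trans ij jr)).
apply: le_trans le_r; apply: alpha_homo => //; lia.
Qed.

Lemma queue0 r h : nonneg_U r h -> alpha h r.-1 r <= alpha h 0 r ->
  queue r (Ugrad h) (fun _ _ => 0).
Proof.
move=> Uge0 le_r; split=> // [i ir|i d id dr].
  by rewrite add0r /Ugrad (alpha_const Uge0 le_r (leqnSn i)) // subrr.
by rewrite add0r min_l // Uge0 // ltnW.
Qed.

(** Induction on the number [m] of entries in row [r], peeling off the first path. *)
Lemma phi_iterP r h m : nonneg_U r h -> diag_triangle r.-1 h ->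
  alpha h r.-1 r - alpha h 0 r = m%:Z ->
  exists Z, [/\ queue r (Ugrad h) Z, row_removed r h (iter m (phi r) h) Z
    & forall k, (0 < k)%N -> (k < r)%N ->
      (\sum_(0 <= t < m) (level (iter t (phi r) h) r == k))%N%:Z = Z k.+1 0%N - Z k 0%N].
Proof.
elim: m h => [|m IHm] h Uge0 tri sum_m.
  exists (fun _ _ => 0); split.
  - by apply: queue0 => //; lia.
  - split=> // [i d i0 id dr|i j ij jr]; first by apply: Uge0 => //; lia.
    by rewrite subr0 addr0.
  - by move=> k _ _; rewrite big_geq.
have r1 : (1 < r)%N by move: sum_m; case: (r) => [|[|]] //; rewrite subrr.
have r0 := ltnW r1.
(* Otherwise no U_{ir} is positive, and alpha_{ir} could not increase in [i] as [sum_m] demands. *)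
have pr : (0 < path_row h r r)%N.
  rewrite lt0n; apply/eqP => pr0; have [_] := path_row_spec h (leqnn r).
  rewrite pr0 path_row_last => U_le.
  suff : forall i, (i < r)%N -> alpha h i r <= alpha h 0 r.
    by move/(_ r.-1); rewrite prednK // leqnn => /(_ isT); lia.
  elim=> // i IHi ir; apply: le_trans (IHi (ltnW ir)).
  by rewrite -subr_le0; exact: U_le.
have Uge0' : nonneg_U r (phi r h) by exact: Ugrad_phi_ge0.
have pj_le j : (0 < j)%N -> (j < r)%N -> (path_row h r j.+1 <= j)%N.
  by move=> j0 jr; rewrite -ltnS path_row_ltn.
have tri' : diag_triangle r.-1 (phi r h).
  move=> j j0 jr; have {}jr : (j < r)%N by lia.
  rewrite gamma_phi // beta_phi // alpha_phi ?(ltnW jr) // tri //; last by lia.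
  (* Since [p j < j] and [p j.+1 <= j], the label [alpha j.-1 j] drops only if [p j.+1 = j], exactly
     when [beta j j] grows. *)
  have := pj_le _ j0 jr; have := path_row_ltn h j0 (ltnW jr).
  rewrite prednK //; case: (ltngtP j (path_row h r j.+1)); case: (ltnP j.-1 (path_row h r j)); lia.
have sum_m' : alpha (phi r h) r.-1 r - alpha (phi r h) 0 r = m%:Z.
  rewrite !alpha_phi // path_row_last r0 pr prednK // leqnn.
  by rewrite leqNgt path_row_ltn //=; lia.
have [Z [Zq [U_ge tri_h' gammaE alphaE] cnt]] := IHm _ Uge0' tri' sum_m'.
exists (fun d i => Z d i + (i < path_row h r d)%N%:R); split.
- exact: queue_phi.
- rewrite iterSr; split=> // [j j0 jr|i j ij jr]; first by rewrite gammaE // gamma_phi.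
  by rewrite alphaE // alpha_phi ?(leq_ltn_trans _ ij) ?(ltnW jr) //; lia.
- move=> k k0 kr; rewrite big_nat_recl // PoszD.
  under eq_bigr do rewrite iterSr.
  rewrite cnt //=; have := level_eq h k0 kr; lia.
Qed.

(** * The successive hives solve the octahedron recurrence *)

(** The removals read beta and gamma only on the diagonal, through the exponents and [ell]; paths
    depend on alpha alone. *)
Definition agree_below (r : nat) (h h' : labels) : Prop :=
  forall j, (j < r)%N ->
  [/\ forall i, alpha h i j = alpha h' i j, beta h j j = beta h' j j
    & gamma h j j = gamma h' j j].

Lemma agree_refl r h : agree_below r h h.
Proof. by []. Qed.

Lemma agree_trans r h1 h2 h3 : agree_below r h1 h2 -> agree_below r h2 h3 -> agree_below r h1 h3.
Proof.
move=> a12 a23 j jr; have [aE bE gE] := a12 j jr; have [aE' bE' gE'] := a23 j jr.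
by split=> [i||]; rewrite ?aE ?bE ?gE.
Qed.

Lemma agree_kappa r h : agree_below r (kappa r h) h.
Proof. by move=> j jr; split=> [i||] /=; rewrite jr. Qed.

Lemma agree_chi r m h : agree_below r (iter m (chi r) h) h.
Proof.
elim: m => [|m IHm]; first exact: agree_refl.
apply: agree_trans IHm => j jr; split=> [i||] //=; by rewrite (ltn_eqF jr) subr0.
Qed.

Lemma agree_omega r m h : agree_below r (iter m (omega r) h) h.
Proof.
elim: m => [|m IHm]; first exact: agree_refl.
apply: agree_trans IHm => j jr; split=> [i||] //=; by rewrite (ltn_eqF jr) andbF subr0.
Qed.

Lemma alpha_iter_chi r m h : alpha (iter m (chi r) h) = alpha h.
Proof. by elim: m => //= m ->. Qed.

Lemma row_removed_agree r h1 h1' h2 h2' Z : (0 < r)%N ->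
  agree_below r h1 h1' -> agree_below r h2 h2' ->
  row_removed r h1 h2 Z -> row_removed r h1' h2' Z.
Proof.
move=> r0 ag1 ag2 [Uge tri gE aE]; split=> [i d i0 id dr|j j0 jr|j j0 jr|i j ij jr].
- have [a2 _ _] := ag2 d ltac:(lia); have := Uge i d i0 id dr.
  by rewrite /Ugrad !a2.
- by have [a2 b2 g2] := ag2 j ltac:(lia); rewrite -a2 -b2 -g2 tri.
- by have [_ _ <-] := ag2 j jr; have [_ _ <-] := ag1 j jr; exact: gE.
- by have [<- _ _] := ag2 j jr; have [a1 _ _] := ag1 j jr; rewrite -a1; exact: aE.
Qed.

Lemma ellP h r :
  reflect (forall k, (0 < k)%N -> (k <= r)%N -> 0 < gamma h k k) (ell h r == r).
Proof.
rewrite (_ : (_ == r) = all (fun k => 0 < gamma h k k) (iota 1 r)); last first.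
  by rewrite all_count size_iota.
apply: (iffP allP) => [pos k k0 kr|pos k].
  by apply: pos; rewrite mem_iota k0 add1n.
by rewrite mem_iota add1n => /andP[]; exact: pos.
Qed.

(* What the path removals use of an LR hive; unlike the hive conditions it is
   immediate for sigma n a. *)
Definition removal_ready (r : nat) (h : labels) : Prop :=
  [/\ nonneg_U r h, diag_triangle r h
    & forall d i, (0 < i)%N -> (i < d)%N -> (d <= r)%N -> ell h d != d -> Ugrad h i d = 0].

Lemma alpha_last_const r h : (0 < r)%N ->
  (forall i, (0 < i)%N -> (i < r)%N -> Ugrad h i r = 0) ->
  alpha h r.-1 r = alpha h 0 r.
Proof.
move=> r0 U0; suff aE i : (i < r)%N -> alpha h i r = alpha h 0 r by rewrite aE // prednK.
elim: i => // i IHi ir; rewrite -(IHi (ltnW ir)); apply/eqP; rewrite -subr_eq0.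
by apply/eqP; exact: (U0 i.+1).
Qed.

Lemma theta_kappaP r h : removal_ready r.+1 h ->
  removal_ready r (kappa r.+1 (theta r.+1 h)) /\
  exists Z, [/\ queue r.+1 (Ugrad h) Z, row_removed r.+1 h (kappa r.+1 (theta r.+1 h)) Z
    & forall k, (0 < k)%N -> (k < r.+1)%N ->
      (num_level h k r.+1)%:Z = Z k.+1 0%N - Z k 0%N].
Proof.
move=> [Uge tri U0]; pose h' := kappa r.+1 (theta r.+1 h).
have [Z [Zq rem cnt]] : exists Z, [/\ queue r.+1 (Ugrad h) Z, row_removed r.+1 h h' Z
    & forall k, (0 < k)%N -> (k < r.+1)%N ->
      (num_level h k r.+1)%:Z = Z k.+1 0%N - Z k 0%N].
  rewrite /h' /theta /num_level; case: ifPn => [_|ell_r]; last first.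
    (* Here [theta] is the identity and the last clause of [removal_ready] empties the top row, so
       no entry moves. *)
    exists (fun _ _ => 0); split=> //.
      by apply: queue0 => //; rewrite alpha_last_const // => i i0 ir; apply: U0.
    apply: (@row_removed_agree _ h h h) => //.
      by move=> j jr; have [aE -> ->] := agree_kappa h jr; split=> // i; rewrite aE.
    split=> // [i d i0 id dr|j j0 jr|i j ij jr].
    - by apply: Uge => //; exact: leqW.
    - by apply: tri => //; exact: leqW.
    - by rewrite subr0 addr0.
  pose h1 := iter (num_chi h r.+1) (chi r.+1) h.
  have a1 : alpha h1 = alpha h by exact: alpha_iter_chi.
  have U1 : Ugrad h1 = Ugrad h by rewrite /Ugrad a1.
  have ag1 : agree_below r.+1 h1 h by exact: agree_chi.
  have Uge1 : nonneg_U r.+1 h1 by rewrite /nonneg_U U1.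
  have tri1 : diag_triangle r h1.
    by move=> j j0 jr; have [-> -> ->] := ag1 j jr; apply: tri => //; exact: leqW.
  (* By the triangle condition the exponent of [phi] is the row sum; [alpha_homo] makes it
     nonnegative, so the absolute value is harmless. *)
  have sum1 : alpha h1 r r.+1 - alpha h1 0 r.+1 = (num_phi h r.+1)%:Z.
    have := alpha_homo Uge (leq0n r) (ltnSn r).
    by rewrite a1 /num_phi tri //=; lia.
  have [Z [Zq rem cnt]] := phi_iterP Uge1 tri1 sum1.
  exists Z; split=> //; first by rewrite -U1.
  apply: row_removed_agree rem => //.
  by move=> j jr; have [aE -> ->] := agree_trans (agree_kappa _) (agree_omega (num_omega h r.+1)
    (iter (num_phi h r.+1) (phi r.+1) h1)) jr; split=> // i; rewrite aE.
split; last by exists Z.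
have [Uge' tri' gE aE] := rem; split=> // d i i0 id dr ell_d.
(* The labels [gamma h k k] survive, so a deficient length at [d] means that [theta] acted as the
   identity. *)
have ell_r : ell h r.+1 != r.+1.
  apply: contraNN ell_d => /ellP pos; apply/ellP => k k0 kd.
  by rewrite gE //; [apply: pos|]; lia.
rewrite /theta (negPf ell_r) /Ugrad.
have [aE' _ _] := agree_kappa h (dr : (d < r.+1)%N); rewrite !aE'; apply: U0 => //.
  exact: leqW.
apply: contraNN ell_d => /ellP pos; apply/ellP => k k0 kd.
by rewrite gE //; [apply: pos|]; lia.
Qed.

Lemma hive_at_top h n : hive_at h n n = h.
Proof. by rewrite /hive_at subnn. Qed.

Lemma hive_atE h n r : (r < n)%N -> hive_at h n r = kappa r.+1 (theta r.+1 (hive_at h n r.+1)).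
Proof. by move=> rn; rewrite /hive_at -(subnSK rn) /= subKn. Qed.

Lemma removal_ready_hive_at h n r : removal_ready n h -> (r <= n)%N ->
  removal_ready r (hive_at h n r) /\
  (forall j, (0 < j)%N -> (j <= r)%N -> gamma (hive_at h n r) j j = gamma h j j).
Proof.
move=> good_h; have [m] := ubnP (n - r); elim: m r => // m IHm r ltm.
rewrite leq_eqVlt => /predU1P[->|rn]; first by rewrite hive_at_top.
have [good_r gE] := IHm r.+1 ltac:(lia) rn.
have [good_r' [Z [_ [_ _ gE' _] _]]] := theta_kappaP good_r.
rewrite hive_atE //; split=> // j j0 jr.
by rewrite gE' // gE //; exact: leqW.
Qed.

Lemma queue_last r h Z i : queue r (Ugrad h) Z -> (i < r)%N ->
  Z r i = alpha h r.-1 r - alpha h i r.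
Proof.
case=> Z0 Zr _; have [m] := ubnP (r - i); elim: m i => // m IHm i ltm.
rewrite leq_eqVlt => /predU1P[ir|ir].
  by have := Z0 i; rewrite ir => -> //; rewrite -ir subrr.
by rewrite Zr // IHm /Ugrad //=; lia.
Qed.

(** * Vertex labels of the successive hives *)

Section Growth.

Variables (n : nat) (a : vertices).
Hypothesis good_a : removal_ready n (edges a).
Local Notation H := (hive_at (edges a) n).

(** Summation along row [i] starts on the lower boundary, whose surviving labels no removal
    changes. *)
Definition stage_vertices (r i d : nat) : int :=
  a i i + \sum_(i <= j < d) alpha (H r) i j.+1.
Local Notation f := stage_vertices.

Lemma stage_vertices_diag r i : f r i i = a i i.
Proof. by rewrite /f big_geq // addr0. Qed.

Lemma stage_verticesS r i d : (i <= d)%N -> f r i d.+1 = f r i d + alpha (H r) i d.+1.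
Proof. by move=> id; rewrite /f big_nat_recr // addrA. Qed.

Lemma stage_vertices_top i d : (i <= d)%N -> f n i d = a i d.
Proof.
elim: d => [|d IHd]; first by rewrite leqn0 => /eqP->; rewrite stage_vertices_diag.
rewrite leq_eqVlt => /predU1P[<-|id]; first exact: stage_vertices_diag.
by rewrite stage_verticesS // IHd // hive_at_top /= addrC subrK.
Qed.

Lemma Ugrad_stage r i d : (i < d)%N ->
  Ugrad (H r) i.+1 d.+1 = f r i.+1 d.+1 - f r i.+1 d - f r i d.+1 + f r i d.
Proof.
by move=> id; rewrite !stage_verticesS ?(ltnW id) // /Ugrad /=; lia.
Qed.

(** The edge changes [- Z j.+1 i + Z j i] telescope along row [i], starting from [Z i.+1 i = 0]. *)
Lemma stage_step r : (r < n)%N ->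
  exists Z, [/\ queue r.+1 (Ugrad (H r.+1)) Z,
    forall i d, (i <= d)%N -> (d <= r)%N -> f r i d = f r.+1 i d - Z d.+1 i
  & forall k, (0 < k)%N -> (k <= r)%N ->
      (Vgrad (edges a) n k r.+1)%:Z = Z k.+1 0%N - Z k 0%N].
Proof.
move=> rn; have [good_r _] := removal_ready_hive_at good_a rn.
have [_ [Z [Zq [_ _ _ aE] cnt]]] := theta_kappaP good_r.
exists Z; split=> // i d; elim: d => [|d IHd].
  by rewrite leqn0 => /eqP-> _; case: Zq => Z0 _ _; rewrite !stage_vertices_diag Z0 ?subr0.
rewrite leq_eqVlt => /predU1P[->|id] dr.
  by case: Zq => Z0 _ _; rewrite !stage_vertices_diag Z0 ?subr0.
by rewrite !stage_verticesS // IHd ?(ltnW dr) // hive_atE // aE //; lia.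
Qed.

Lemma growth_stage : growth n a f.
Proof.
split=> [i d id _|r i _ _|r i ir rn|r i d id dr rn].
- exact: stage_vertices_top.
- exact: stage_vertices_diag.
- have [m] := ubnP (n - r); elim: m r i ir rn => // m IHm r i ir + ltm.
  rewrite leq_eqVlt => /predU1P[rn|rn]; first by subst r; rewrite stage_vertices_top //; lia.
  have [Z [Zq fE _]] := stage_step rn; rewrite fE // (queue_last Zq) //=.
  have := IHm r.+1 i (leqW ir) rn ltac:(lia); have := IHm r.+1 r (leqnSn r) rn ltac:(lia).
  by rewrite !stage_verticesS // stage_vertices_diag; lia.
(* With [Z d.+1 i = f r.+1 i d - f r i d], the minimum in the queue recursion becomes the maximum of
   [octahedral]. *)
- have [Z [[_ _ Zd] fE _]] := stage_step rn.
  have := Zd i d.+1 ltac:(lia) ltac:(lia); rewrite Ugrad_stage //.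
  have := fE i d (ltnW id) (ltnW dr); have := fE i.+1 d id (ltnW dr).
  have := fE i d.+1 (leqW (ltnW id)) dr; have := fE i.+1 d.+1 (ltnW id) dr; lia.
Qed.

Lemma Vgrad_stage k r : (0 < k)%N -> (k < r)%N -> (r <= n)%N ->
  (Vgrad (edges a) n k r)%:Z = f r 0 k - f r 0 k.-1 - (f r.-1 0 k - f r.-1 0 k.-1).
Proof.
case: r => // r k0 kr rn; have [Z [_ fE ->//]] := stage_step rn.
by case: k k0 kr => // k _ kr; rewrite /= !fE ?(ltnW kr) //; lia.
Qed.

Hypothesis a00 : a 0%N 0%N = 0.

Lemma sigma_stage i j : (i <= j)%N -> (j <= n)%N ->
  sigma n a i j = f j 0 i + a j n - a 0%N n.
Proof.
move=> ij jn; rewrite /sigma /vertices_of.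
under eq_bigr do rewrite /= big_geq // addr0.
rewrite big_add1 /= telescope_sumr //.
have -> : \sum_(1 <= k < i.+1) beta (sigma_labels n (edges a)) k j = f j 0 i - f j 0 0.
  rewrite big_add1 /= -(telescope_sumr (f j 0) (leq0n i)).
  rewrite big_nat_cond [RHS]big_nat_cond; apply: eq_bigr => k /andP[/andP[_ ki] _] /=.
  (* V_{k+1,m} is [D m - D m.-1] and mu_{k+1} is [D n], so the beta label is [D j]. *)
  pose D m := f m 0%N k.+1 - f m 0%N k.
  rewrite (_ : \sum_(_ <= m < _) _ = D n - D j); last first.
    rewrite big_add1 /= -(telescope_sumr D jn) big_nat_cond [RHS]big_nat_cond.
    apply: eq_bigr => m /andP[/andP[jm mn] _]; rewrite Vgrad_stage //.
    by rewrite ltnS (leq_trans ki) // (leq_trans ij).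
  by rewrite /D !stage_vertices_top //; lia.
by rewrite stage_vertices_diag a00; lia.
Qed.

(** The U-gradients of [sigma n a] count paths, and lambda is kept by [f_right]; for deficient
    length the counts are 0 by definition. *)
Lemma removal_ready_sigma : removal_ready n (edges (sigma n a)).
Proof.
have [_ _ f_right _] := growth_stage.
have UE i d : (0 < i)%N -> (i < d)%N -> (d <= n)%N ->
    Ugrad (edges (sigma n a)) i d = (Vgrad (edges a) n i d)%:Z.
  move=> i0 id dn; rewrite Vgrad_stage // /Ugrad /= !sigma_stage; try lia.
have gE k : (0 < k)%N -> (k <= n)%N ->
    gamma (edges (sigma n a)) k k = gamma (edges a) k k.
  by move=> k0 kn; rewrite /= !sigma_stage ?f_right //; lia.
split=> [i d i0 id dn|j j0 jn|d i i0 id dn ell_d].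
- by rewrite UE.
- by rewrite /=; lia.
- rewrite UE // /Vgrad /num_level ifN //; apply: contraNN ell_d => /ellP pos.
  apply/ellP => k k0 kd; have kn := leq_trans kd dn.
  by rewrite gE // -(removal_ready_hive_at good_a dn).2 // pos.
Qed.

End Growth.

(** For the last clause: deficient length forces lambda_d <= 0, hence alpha_{d-1,d} <= 0 as
    beta_{dd} >= 0. The labels alpha_{id} are nonnegative and increase with i, so all vanish. *)
Lemma removal_ready_LR_hive n a : is_LR_hive n a -> removal_ready n (edges a).
Proof.
move=> [[a00 grad] alpha_ge0 bg_ge0].
have Uge : nonneg_U n (edges a) by move=> i d i0 id dn; have [] := grad i d i0 id dn.
have tri : diag_triangle n (edges a) by move=> j _ _ /=; lia.
split=> // d i i0 id dn ell_d.
have gle k m : (0 < k)%N -> (k <= m)%N -> (m <= n)%N -> gamma (edges a) m m <= gamma (edges a) k k.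
  move=> k0; elim: m => [|m IHm]; first by case: k k0.
  rewrite leq_eqVlt => /predU1P[->//|km] mn; apply: le_trans (IHm km (ltnW mn)).
  (* lambda_m - lambda_{m+1} is the sum of the R- and L-gradients at (m, m+1). *)
  have [] := grad m m.+1 ltac:(lia) (ltnSn m) mn; rewrite /Rgrad /Ugrad /Lgrad /=; lia.
have g0 : gamma (edges a) d d <= 0.
  rewrite leNgt; apply: contraNN ell_d => gd; apply/ellP => k k0 kd.
  exact: lt_le_trans gd (gle _ _ k0 kd dn).
have d0 : (0 < d)%N := leq_ltn_trans (leq0n _) id.
have [bd _] := bg_ge0 d d d0 (leqnn d) dn.
have Uge' : nonneg_U d (edges a) by move=> ? ? ? ? ?; apply: Uge => //; lia.
have := alpha_homo Uge' (_ : i <= d.-1)%N (_ : d.-1 < d)%N.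
have := alpha_ge0 i.-1 d ltac:(lia) dn; have := Uge i d i0 id dn; have := tri d d0 dn.
rewrite /Ugrad => E1 E2 E3 E4; have := E4 ltac:(lia) ltac:(lia); lia.
Qed.

Theorem theorem10p8 (n : nat) (a : vertices) :
  (0 < n)%N -> is_LR_hive n a ->
  forall i j : nat, (i <= j)%N -> (j <= n)%N -> sigma n (sigma n a) i j = a i j.
Proof.
move=> _ LR_a i j ij jn; have good_a := removal_ready_LR_hive LR_a; have [[a00 _] _ _] := LR_a.
have good_b := removal_ready_sigma good_a a00.
have b00 : sigma n a 0 0 = 0 by rewrite /sigma /vertices_of !big_geq.
rewrite (sigma_stage good_b b00) //.
apply: (growth_swap_inv (growth_stage good_a) (growth_stage good_b)) => //.
exact: sigma_stage.
Qed.
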